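(* For each integer $n \geq 1$, let $f(X) = \sum_{i=0}^n \pm X^i$ be a random polynomial of degree $n$ whose $n+1$ coefficients are independent random variables taking the values $1$ and $-1$ with probability $1/2$ each, and let $\mathbb{P}(f \text{ is irreducible})$ denote the probability that $f$ is irreducible over $\mathbf{Q}$. Then $$\limsup_{n \to \infty} \mathbb{P}(f \text{ is irreducible}) = 1.$$
   Context: A polynomial with all coefficients in $\{1,-1\}$ is called a Littlewood polynomial. ''Irreducible'' means irreducible in $\mathbf{Q}[X]$. *)

(* Defs.v *)
From HB Require Import structures.
From mathcomp Require Import all_boot all_order all_algebra.
From mathcomp Require Import all_classical all_reals all_analysis.

Set Implicit Arguments.
Unset Strict Implicit.
Unset Printing Implicit Defensive.

Import Order.TTheory GRing.Theory Num.Theory.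

Local Open Scope classical_set_scope.
Local Open Scope ring_scope.

(* MathComp-Analysis puts the discrete sigma-algebra on unit, bool and nat,
   but provides no measurable structure on int. *)
HB.instance Definition _ := isPointed.Build int 0.

HB.instance Definition _ := @isMeasurable.Build default_measure_display
  int discrete_measurable discrete_measurable0
  discrete_measurableC discrete_measurableU.

Section Independence.
Context (R : realType) (d d' : measure_display).
Context (T : measurableType d) (T' : measurableType d') (P : probability T R).

Definition mutually_independent (I : finType) (X : I -> {RV P >-> T'}) : Prop :=
  forall (J : {set I}) (A : I -> set T'),
    (forall i, i \in J -> measurable (A i)) ->
    P [set w | forall i, i \in J -> A i (X i w)] =
    (\prod_(i in J) P [set w | A i (X i w)])%E.

End Independence.

Section RandomLittlewood.
Context (R : realType) (d : measure_display).
Context (T : measurableType d) (P : probability T R).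

Definition random_sign (X : {RV P >-> int}) : Prop :=
  P [set w | X w = 1] = (2^-1)%:E /\ P [set w | X w = -1] = (2^-1)%:E.

Definition random_poly n (eps : 'I_n.+1 -> {RV P >-> int}) (w : T) : {poly rat} :=
  \sum_(i < n.+1) (eps i w)%:~R *: 'X^i.

End RandomLittlewood.

(* Main.v *)
Require Import Defs.
From HB Require Import structures.
From mathcomp Require Import all_boot all_order all_algebra all_field.
From mathcomp Require Import boolp.
From mathcomp Require Import zify ring.

Set Implicit Arguments.
Unset Strict Implicit.
Unset Printing Implicit Defensive.

Import Order.TTheory GRing.Theory Num.Theory.

Local Open Scope ring_scope.

(** Probabilities are at most 1, so it is enough to find degrees [n] for which
    [f] is irreducible with probability close to 1; the degrees [n = 2^k - 1]
    will do.

    For such an [n], every sign polynomial is congruent modulo 2 to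
    [1 + X + ... + X^n = (X^(2^k) - 1) / (X - 1) = (X - 1)^n], so [f(X + 1)]
    is congruent to [X^n].  If its constant coefficient is not divisible by 4,
    then Eisenstein's criterion applies, but this happens only half of the
    time.  More generally, if [f = g h] with both factors of degree at least
    [A], then [g(X + 1)] and [h(X + 1)] are congruent to monomials of degree at
    least [A] modulo 2, and hence the [A] lowest coefficients of [f(X + 1)] are
    all divisible by 4 ([dvdz4_coef_shift1]).  These are [A] independent
    conditions modulo 2 on the signs, so they hold with probability at most
    [2^-A] ([card_low_coefs_dvd4]).

    Outside of that event a reducible [f] has a factor of degree less than [A],
    with [A] fixed.  The complex roots of a sign polynomial have modulus at
    most 2, so the coefficients of its factors of degree less than [A] are
    bounded independently of [n]: such a factor has a root in a finite list of
    algebraic numbers that depends on [A] only ([small_factor_root]).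
    Finally [f] vanishes at a fixed number [a] with probability tending to 0
    ([vanishing_rare]).  If [a] is not a root of unity, then no two sign
    polynomials vanishing at [a] are at Hamming distance at most 2, and there
    is only room for a proportion [1 / (n + 1)] of them.  If [a^M = 1], then
    once the other signs are chosen, the signs in the positions divisible by
    [M] must have a prescribed sum, and a binomial coefficient [C(m, j)] is
    negligible with respect to [2^m].

    A sign polynomial of degree [n] is encoded by the set [T] of the positions
    of its coefficients [-1], and all the above are cardinality bounds on sets
    of such [T].  Independence enters only to give all the sign patterns the
    same probability ([prob_sign_pattern]). *)

(** * Binomial coefficients are small compared with powers of two *)

(** This is [C(2m, m) <= 4^m / sqrt(2m + 1)], squared so as to stay within the
    natural numbers. *)
Lemma central_bin_sq_le m :
  (('C(m.*2, m) ^ 2 * m.*2.+1) <= 16 ^ m)%N.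
Proof.
elim: m => [|m IH]; first by rewrite bin0.
have E : (m.+1 * 'C(m.+1.*2, m.+1) = 2 * (m.*2.+1 * 'C(m.*2, m)))%N.
  have h1 := mul_bin_diag m.*2.+2 m.
  have h2 : ('C(m.*2.+1, m) = 'C(m.*2.+1, m.+1))%N.
    rewrite -[RHS]bin_sub; last by lia.
    by congr 'C(_, _); lia.
  have h3 := mul_bin_diag m.*2.+1 m.
  rewrite doubleS -h1 [_.-1]/= h2 h3; lia.
suff : (m.+1 ^ 2 * ('C(m.+1.*2, m.+1) ^ 2 * m.+1.*2.+1) <= m.+1 ^ 2 * 16 ^ m.+1)%N.
  by rewrite leq_pmul2l.
rewrite mulnA -expnMn E (expnS 16).
apply: leq_trans (_ : 16 * m.+1 ^ 2 * ('C(m.*2, m) ^ 2 * m.*2.+1) <= _)%N; last first.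
  by rewrite (mulnCA _ 16%N) -mulnA !leq_mul2l IH !orbT.
set c := 'C(_, _).
have -> : ((2 * (m.*2.+1 * c)) ^ 2 * m.+1.*2.+1
    = c ^ 2 * m.*2.+1 * (4 * m.*2.+1 * m.+1.*2.+1))%N by lia.
have -> : (16 * m.+1 ^ 2 * (c ^ 2 * m.*2.+1)
    = c ^ 2 * m.*2.+1 * (16 * m.+1 ^ 2))%N by lia.
(* What remains is (2m + 1) (2m + 3) <= (2m + 2)^2. *)
by rewrite leq_mul2l; apply/orP; right; lia.
Qed.

(** The square of [C(m, k)] is the term of index [k] of the Vandermonde sum
    [C(m, 0) C(m, m) + ... + C(m, m) C(m, 0) = C(2m, m)]. *)
Lemma bin_pow4_le m k : ('C(m, k) ^ 4 * m.*2.+1 <= 16 ^ m)%N.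
Proof.
have [lt_mk|le_km] := ltnP m k; first by rewrite bin_small // exp0n.
apply: leq_trans (central_bin_sq_le m).
rewrite leq_mul2r; apply/orP; right.
rewrite (_ : 4%N = (2 * 2)%N) // expnM leq_exp2r //.
rewrite -addnn -(binomial.Vandermonde m m m).
rewrite (bigD1 (inord k : 'I_m.+1)) //= inordK //.
by rewrite bin_sub // expnS expn1 leq_addr.
Qed.

Lemma mul_bin_leq_expn2 K m k : (K ^ 4 <= m -> K * 'C(m, k) <= 2 ^ m)%N.
Proof.
move=> leKm; rewrite -(@leq_exp2r _ _ 4) // expnMn -expnM mulnC.
rewrite -[in X in (_ <= X)%N]mulnC expnM.
rewrite (_ : 2 ^ 4 = 16)%N //; apply: leq_trans (bin_pow4_le m k).
by rewrite leq_mul2l; apply/orP; right; lia.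
Qed.

(** * Sign polynomials *)

Section SignPolynomials.
Variable n : nat.
Implicit Types T : {set 'I_n.+1}.

Definition littlewood (R : nzRingType) T : {poly R} :=
  \poly_(i < n.+1) (-1) ^+ (inord i \in T).

Lemma coef_littlewood (R : nzRingType) T (i : 'I_n.+1) :
  (littlewood R T)`_i = (-1) ^+ (i \in T).
Proof. by rewrite coef_poly ltn_ord inord_val. Qed.

Lemma littlewoodE (R : nzRingType) T :
  littlewood R T = \sum_(i < n.+1) (-1) ^+ (i \in T) *: 'X^i.
Proof. by rewrite /littlewood poly_def; apply: eq_bigr => i _; rewrite inord_val. Qed.

Lemma size_littlewood (R : nzRingType) T : size (littlewood R T) = n.+1.
Proof. by rewrite size_poly_eq // signr_eq0. Qed.

Lemma map_littlewood (R S : nzRingType) (f : {rmorphism R -> S}) T :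
  map_poly f (littlewood R T) = littlewood S T.
Proof.
apply/polyP=> i; rewrite coef_map !coef_poly; case: ifP => _; last exact: rmorph0.
exact: rmorph_sign.
Qed.

Lemma horner_littlewood (R : comNzRingType) T (x : R) :
  (littlewood R T).[x] = \sum_(i < n.+1) (-1) ^+ (i \in T) * x ^+ i.
Proof.
rewrite littlewoodE horner_sum; apply: eq_bigr => i _.
by rewrite hornerZ hornerXn.
Qed.

End SignPolynomials.
Arguments littlewood {n} R T.

(** * Vanishing at a fixed algebraic number *)

Section Roots.
Variable n : nat.
Implicit Types (T : {set 'I_n.+1}) (a : algC).

Definition vanishing a := [set T : {set 'I_n.+1} | root (littlewood algC T) a].

(** Changing the sign in position [i] changes the value at [a] by [2 a^i] up to
    sign, and the numbers [a^i] are distinct up to sign.  Hence the sets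
    obtained by one sign change from the elements of [vanishing a] are all
    distinct: there are [#|vanishing a| * n.+1] of them. *)
Lemma card_vanishing_nonunity a :
    (forall M, (0 < M)%N -> a ^+ M != 1) ->
  (#|vanishing a| * n.+1 <= 2 ^ n.+1)%N.
Proof.
move=> a_free.
pose flip (p : {set 'I_n.+1} * 'I_n.+1) := [set j | (j \in p.1) (+) (j == p.2)].
have dist T i : (littlewood algC (flip (T, i))).[a] =
    (littlewood algC T).[a] - 2 * (-1) ^+ (i \in T) * a ^+ i.
  rewrite !horner_littlewood (bigD1 i) //= [in RHS](bigD1 i) //= inE eqxx /= addbT.
  rewrite (eq_bigr (fun j : 'I_n.+1 => (-1) ^+ (j \in T) * a ^+ j)); last first.
    by move=> j /negbTE ne; rewrite inE /= ne addbF.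
  by case: (i \in T) => /=; rewrite ?expr0 ?expr1; ring.
have [a0|a_neq0] := eqVneq a 0.
  suff -> : vanishing a = set0 by rewrite cards0.
  apply/setP=> T; rewrite !inE a0 rootE horner_coef0.
  by rewrite (coef_littlewood _ T ord0) signr_eq0.
have pow_inj (i j : 'I_n.+1) : a ^+ i ^+ 2 = a ^+ j ^+ 2 -> i = j.
  wlog le_ij : i j / (i <= j)%N => [wlog_ij eq_ij|].
    by have [/wlog_ij|/ltnW/wlog_ij] := leqP i j; [apply|move->].
  move=> eq_ij; apply/val_inj/eqP; rewrite eqn_leq le_ij leqNgt /=; apply/negP=> lt_ij.
  have /eqP[] := a_free ((j - i) * 2)%N ltac:(lia).
  rewrite exprM expfB_cond ?(negbTE a_neq0) // expr_div_n -eq_ij.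
  by rewrite divff // !expf_neq0.
rewrite -[X in (_ * X)%N](card_ord n.+1) -cardsT -cardsX.
rewrite -(card_in_imset (f := flip)) => [|[T i] [T' j] /=]; last first.
  rewrite !inE !andbT => /eqP rT /eqP rT' eqTT'.
  have eq_ij : i = j.
    apply: pow_inj.
    have := dist T' j; rewrite -eqTT' dist rT rT' !sub0r => /oppr_inj.
    rewrite -!mulrA => /mulfI -/(_ ltac:(by rewrite pnatr_eq0)).
    by move/(congr1 (fun x => x ^+ 2)); rewrite /= !exprMn !sqrr_sign !mul1r.
  congr (_, _) => //; apply/setP=> k; move/setP/(_ k): eqTT'.
  by rewrite !inE /= eq_ij => /addIb.
rewrite (leq_trans (max_card _)) // -cardsT -powersetT card_powerset.
by rewrite cardsT card_ord.
Qed.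

Lemma sum_signs (D T : {set 'I_n.+1}) (R : nzRingType) :
  \sum_(i in D) (-1) ^+ (i \in T) = #|D|%:R - #|T :&: D|%:R *+ 2 :> R.
Proof.
rewrite -!sum1_card !natr_sum -sumrMnl [\sum_(i in _ :&: _) _]big_mkcond.
rewrite [LHS]big_mkcond [\sum_(i in D) _]big_mkcond -sumrB.
apply: eq_bigr => i _; rewrite inE; case: (i \in T); case: (i \in D) => //=.
- by rewrite expr1 mulr2n opprD addNKr.
all: by rewrite ?expr0 subr0.
Qed.

(** Let [D] be the set of the positions divisible by [M].  When the signs
    outside of [D] are given, the vanishing at [a] prescribes the sum of the
    signs in [D], that is, the number of minus signs in [D]. *)
Lemma card_vanishing_unity K M a :
    (0 < M)%N -> a ^+ M = 1 -> (K ^ 4 <= n %/ M)%N ->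
  (K * #|vanishing a| <= 2 ^ n.+1)%N.
Proof.
move=> M_gt0 aM1 leK; pose D := [set i : 'I_n.+1 | (M %| i)%N].
have leKD : (K ^ 4 <= #|D|)%N.
  apply: leq_trans leK _.
  pose f (j : 'I_(n %/ M)) : 'I_n.+1 := inord (j * M).
  have fE j : f j = (j * M)%N :> nat.
    by rewrite inordK // ltnS -leq_divRL // ltnW.
  have f_inj : injective f.
    move=> i j /(congr1 val); rewrite /= !fE => /eqP.
    by rewrite eqn_pmul2r // => /eqP/val_inj.
  rewrite -[leqLHS]card_ord -cardsT -(card_imset _ f_inj); apply/subset_leq_card.
  by apply/subsetP=> _ /imsetP[j _ ->]; rewrite inE fE dvdn_mull.
have eval T : (littlewood algC T).[a] = #|D|%:R - #|T :&: D|%:R *+ 2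
    + \sum_(i in ~: D) (-1) ^+ (i \in T :\: D) * a ^+ i.
  rewrite horner_littlewood (bigID (mem D)) /= -sum_signs; congr (_ + _).
    apply: eq_bigr => i; rewrite inE => /dvdnP[q ->].
    by rewrite mulnC exprM aM1 expr1n mulr1.
  by apply: eq_big => [i|i iD]; rewrite ?in_setC // in_setD iD.
have fibre U : (K * #|[set T in vanishing a | T :\: D == U]| <= 2 ^ #|D|)%N.
  set F := [set T in _ | _].
  have [->|/set0Pn[T0]] := eqVneq F set0; first by rewrite cards0 muln0.
  rewrite inE => /andP[]; rewrite inE => /eqP rT0 /eqP UT0.
  apply: leq_trans (mul_bin_leq_expn2 #|T0 :&: D| leKD).
  rewrite leq_mul2l -cards_draws; apply/orP; right.
  rewrite -(card_in_imset (f := fun T => T :&: D)) => [|T T']; last first.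
    rewrite !inE => /andP[_ /eqP <-] /andP[_ /eqP eqD] eqI.
    by rewrite -(setID T D) -(setID T' D) eqI eqD.
  apply/subset_leq_card/subsetP=> V /imsetP[T + ->{V}].
  rewrite !inE => /andP[/eqP rT /eqP UT]; rewrite subsetIr /=.
  move: rT0; rewrite -rT !eval UT UT0 => /addIr/addrI/oppr_inj/eqP.
  by rewrite eqrMn2r /= eqr_nat eq_sym.
rewrite -sum1_card (partition_big (fun T => T :\: D) (mem (powerset (~: D)))) /=;
  last first.
  by move=> T _; rewrite powersetE setDE subsetIr.
rewrite big_distrr /=; apply: (@leq_trans (\sum_(U in powerset (~: D)) 2 ^ #|D|)%N).
  apply: leq_sum => U _; apply: leq_trans (fibre U).
  by rewrite sum1dep_card leq_mul2l subset_leq_card ?orbT.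
by rewrite sum_nat_const card_powerset -expnD addnC cardsC card_ord.
Qed.

End Roots.

(** * Eisenstein's criterion at the point 1, modulo 4 *)

Local Notation shift1 p := (p \Po ('X + 1%:P)).
Local Notation mod2 := (map_poly (intr : int -> 'F_2)).

Lemma pchar_F2 : 2 \in [pchar 'F_2]. Proof. exact: pchar_Fp. Qed.

Lemma coef_mod2_eq0 (p : {poly int}) i : ((mod2 p)`_i == 0) = (2 %| p`_i)%Z.
Proof. by rewrite coef_map (dvdz_pcharf pchar_F2). Qed.

Lemma mod2_shift1 p : mod2 (shift1 p) = shift1 (mod2 p).
Proof. by rewrite map_comp_poly rmorphD /= map_polyX map_polyC rmorph1. Qed.

(** Modulo 2 signs do not matter, and [X] times the shifted geometric sum is
    [(X + 1)^(2^k) - 1 = X^(2^k)] by the Frobenius endomorphism. *)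
Lemma shift1_littlewood_mod2 n k (T : {set 'I_n.+1}) : n.+1 = (2 ^ k)%N ->
  shift1 (littlewood 'F_2 T) = 'X^n.
Proof.
move=> nk; have pcharX : 2 \in [pchar {poly 'F_2}] by rewrite pchar_poly.
have -> : littlewood 'F_2 T = \sum_(i < n.+1) 'X^i.
  rewrite littlewoodE; apply: eq_bigr => i _.
  by rewrite oppr_pchar2 ?pchar_F2 // expr1n scale1r.
apply: (@mulfI _ 'X); rewrite ?polyX_eq0 // -exprS.
have -> : 'X * shift1 (\sum_(i < n.+1) 'X^i)
    = shift1 (('X - 1) * \sum_(i < n.+1) 'X^i) :> {poly 'F_2}.
  by rewrite comp_polyM comp_polyB comp_polyX comp_polyC addrK.
rewrite -subrX1 comp_polyB comp_Xn_poly comp_polyC nk exprDn_pchar.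
  by rewrite expr1n addrK.
by rewrite pnatX; apply/orP; left; rewrite pnatE.
Qed.

Lemma coef_factor_Xn (F : fieldType) (p q : {poly F}) n i :
  p * q = 'X^n -> (i < (size p).-1)%N -> p`_i = 0.
Proof.
move=> pq lt_ip; have : p %| ('X - 0%:P) ^+ n by rewrite subr0 -pq dvdp_mulr.
case/dvdp_exp_XsubCP=> k _; rewrite subr0 => /eqp_eq.
rewrite lead_coefXn scale1r => eq_p.
move: lt_ip; rewrite eq_p coefZ coefXn.
have [->|c0] := eqVneq (lead_coef p) 0; first by rewrite mul0r.
by rewrite size_scale // size_polyXn /=; case: eqP => [->|_]; rewrite ?ltnn ?mulr0.
Qed.

(** The shifted factors reduce to monomials modulo 2, without any loss of
    degree, so their coefficients of index less than [A] are even.  A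
    coefficient of index less than [A] of the product only involves products
    of two of these. *)
Lemma dvdz4_coef_shift1 n k A (T : {set 'I_n.+1}) g h : n.+1 = (2 ^ k)%N ->
    littlewood int T = g * h -> (A < size g)%N -> (A < size h)%N ->
  forall i, (i < A)%N -> (4 %| (shift1 (littlewood int T))`_i)%Z.
Proof.
move=> nk fgh ltAg ltAh i ltiA.
pose G := shift1 g; pose H := shift1 h.
have GH : mod2 G * mod2 H = 'X^n.
  rewrite -rmorphM /= -comp_polyM -fgh mod2_shift1 map_littlewood.
  exact: shift1_littlewood_mod2 nk.
have szG : size G = size g by rewrite size_comp_poly2 // size_XaddC.
have szH : size H = size h by rewrite size_comp_poly2 // size_XaddC.
have [leG leH] : (size (mod2 G) <= size g /\ size (mod2 H) <= size h)%N.
  by rewrite -szG -szH !size_poly.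
have g0 : g != 0 by rewrite -size_poly_gt0; lia.
have h0 : h != 0 by rewrite -size_poly_gt0; lia.
have sz1 := size_littlewood int T; rewrite fgh size_mul // in sz1.
have GH0 : mod2 G * mod2 H != 0 by rewrite GH monic_neq0 // monicXn.
have := GH0; rewrite mulf_eq0 negb_or => /andP[G0 H0].
have sz2 := size_mul G0 H0; rewrite GH size_polyXn in sz2.
have [ltAG ltAH] : (A <= (size (mod2 G)).-1 /\ A <= (size (mod2 H)).-1)%N.
  have arith a b c d : (c + d).-1 = n.+1 -> n.+1 = (a + b).-1 ->
      (a <= c -> b <= d -> A < c -> A < d -> A <= a.-1 /\ A <= b.-1)%N by lia.
  exact: arith sz1 sz2 leG leH ltAg ltAh.
have evenG j : (j < A)%N -> (2 %| G`_j)%Z.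
  by move=> ltjA; rewrite -coef_mod2_eq0 (coef_factor_Xn GH) // (leq_trans ltjA).
have evenH j : (j < A)%N -> (2 %| H`_j)%Z.
  move=> ltjA; rewrite mulrC in GH.
  by rewrite -coef_mod2_eq0 (coef_factor_Xn GH) // (leq_trans ltjA).
rewrite fgh comp_polyM coefM; apply: rpred_sum => j _.
rewrite (_ : 4 = 2 * 2) //; apply: dvdz_mul.
  exact/evenG/(leq_ltn_trans _ ltiA)/leq_ord.
exact/evenH/(leq_ltn_trans _ ltiA)/leq_subr.
Qed.

Definition low_coefs_dvd4 n A := [set T : {set 'I_n.+1} |
  [forall i : 'I_A, (4 %| (shift1 (littlewood int T))`_i)%Z]].

(** The signs in the positions at least [A] determine the other ones.  Indeed,
    if two such polynomials differ only below degree [A], then their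
    difference is [2 D] with [D] of degree less than [A] and with coefficients
    in [{-1, 0, 1}]; all the coefficients of [D(X + 1)] are even, so those of
    [D] are even too, which forces [D = 0]. *)
Lemma card_low_coefs_dvd4 n A : (A <= n.+1)%N ->
  (2 ^ A * #|low_coefs_dvd4 n A| <= 2 ^ n.+1)%N.
Proof.
move=> leAn; pose low := [set i : 'I_n.+1 | (i < A)%N].
have card_low : #|low| = A.
  rewrite -[RHS]card_ord -cardsT -(card_imset _ (f := widen_ord leAn)); last first.
    by move=> i j /(congr1 val) /= /val_inj.
  congr #|pred_of_set _|; apply/setP=> i; rewrite inE.
  apply/idP/imsetP=> [ltiA|[j _ ->]]; last exact: (ltn_ord j).
  by exists (Ordinal ltiA) => //; apply/val_inj.
suff : (#|low_coefs_dvd4 n A| <= 2 ^ #|~: low|)%N.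
  have -> : (2 ^ n.+1 = 2 ^ A * 2 ^ #|~: low|)%N.
    by rewrite -expnD -{1}card_low cardsC card_ord.
  by rewrite leq_mul2l => ->; rewrite orbT.
rewrite -card_powerset.
rewrite -[leqLHS](card_in_imset (f := fun T => T :\: low)) => [|T T']; last first.
  rewrite [T \in _]inE [T' \in _]inE => /forallP badT /forallP badT' eqTT'.
  pose D : {poly int} :=
    \poly_(i < n.+1) ((inord i \in T')%:R - (inord i \in T)%:R).
  have subT : littlewood int T - littlewood int T' = 2 *: D.
    apply/polyP=> i; rewrite coefB coefZ !coef_poly; case: ifP => // _.
    by case: (_ \in T); case: (_ \in T').
  have szD : (size D <= A)%N.
    apply/leq_sizeP=> i leAi; rewrite coef_poly; case: ifP => // ltin.
    have /setP/(_ (inord i)) := eqTT'; rewrite !inE inordK // ltnNge leAi /= => ->.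
    by rewrite subrr.
  have D2 : mod2 D = 0.
    apply/eqP; rewrite -(@comp_poly_eq0 _ _ ('X + 1%:P)) ?size_XaddC //.
    rewrite -mod2_shift1; apply/eqP/polyP => i.
    rewrite coef0; apply/eqP; rewrite coef_mod2_eq0.
    have [leAi|ltiA] := leqP A i.
      by rewrite nth_default // size_comp_poly2 ?size_XaddC // (leq_trans szD).
    have : (4 %| 2 * (shift1 D)`_i)%Z.
      rewrite -coefZ -comp_polyZ -subT comp_polyB coefB rpredB //.
        exact: (badT (Ordinal ltiA)).
      exact: (badT' (Ordinal ltiA)).
    by rewrite (_ : 4 = 2 * 2) // dvdz_mul2l.
  apply/setP=> i; have := coef_mod2_eq0 D i.
  rewrite D2 coef0 eqxx coef_poly ltn_ord inord_val.
  by case: (_ \in T); case: (_ \in T').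
apply/subset_leq_card/subsetP=> V /imsetP[T _ ->].
by rewrite powersetE setDE subsetIr.
Qed.

(** * Factors of bounded degree *)

Local Notation toC := (map_poly (intr : int -> algC)).

(** At a root, [|a|^n] is at most the sum of the lower powers of [|a|], which
    is [(|a|^n - 1) / (|a| - 1)] and so less than [|a|^n] if [|a| > 2]. *)
Lemma root_littlewood_le2 n (T : {set 'I_n.+1}) (a : algC) :
  root (littlewood algC T) a -> `|a| <= 2.
Proof.
move=> /eqP; rewrite horner_littlewood big_ord_recr /= => /eqP.
rewrite addr_eq0 => /eqP/(congr1 Num.norm); rewrite normrN normrMsign normrX => eq_n.
have le_n : `|a| ^+ n <= \sum_(i < n) `|a| ^+ i.
  rewrite -eq_n (le_trans (ler_norm_sum _ _ _)) // ler_sum // => i _.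
  by rewrite normrMsign normrX.
rewrite real_leNgt ?normr_real ?realn //; apply/negP => lt2a.
have : `|a| ^+ n - 1 < `|a| ^+ n by rewrite ltrBlDr ltrDl ltr01.
rewrite subrX1 => /lt_le_trans/(_ le_n)/lt_geF/negbT/negP; apply.
have sum_ge0 : 0 <= \sum_(i < n) `|a| ^+ i.
  by apply: sumr_ge0 => i _; exact: exprn_ge0.
by rewrite ler_peMl // lerBrDr ltW.
Qed.

(** Multiplication by [X - z] with [|z| <= 2] multiplies the largest modulus of
    the coefficients by at most [1 + 2]. *)
Lemma norm_coef_prod_XsubC (rs : seq algC) i : {in rs, forall z, `|z| <= 2} ->
  `|(\prod_(z <- rs) ('X - z%:P))`_i| <= 3 ^+ size rs.
Proof.
elim: rs i => [|z rs IH] i le2.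
  by rewrite big_nil coef1 expr0; case: eqP; rewrite ?normr1 ?normr0 ?ler01.
have IHi j := IH j (fun y yrs => le2 y (mem_behead (s := z :: rs) yrs)).
rewrite big_cons mulrBl coefB coefXM coefCM /= exprS.
rewrite (le_trans (ler_normB _ _)) //.
rewrite (_ : 3 * _ = 3 ^+ size rs + 2 * 3 ^+ size rs); last by ring.
rewrite lerD //; first by case: ifP; rewrite ?normr0 ?exprn_ge0.
by rewrite normrM ler_pM // le2 ?mem_head.
Qed.

Lemma unit_lead_coef_factor n (T : {set 'I_n.+1}) (h q : {poly int}) :
  littlewood int T = h * q -> `|lead_coef h| = 1.
Proof.
move=> fhq; have : (`|lead_coef h| * `|lead_coef q| == 1)%N.
  rewrite -abszM -lead_coefM -fhq lead_coefE size_littlewood.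
  by rewrite (coef_littlewood _ T ord_max) abszX exp1n.
by rewrite muln_eq1 -abszE => /andP[/eqP-> _].
Qed.

(** The leading coefficient of [h] is a unit and its roots are among those of
    the sign polynomial. *)
Lemma coef_factor_littlewood n (T : {set 'I_n.+1}) (h q : {poly int}) A i :
  littlewood int T = h * q -> (size h <= A)%N -> `|h`_i| <= 3 ^+ A.
Proof.
move=> fhq leA; have lc1 := unit_lead_coef_factor fhq.
have [rs hrs] := closed_field_poly_normal (toC h).
have lcC1 : `|lead_coef (toC h)| = 1.
  by rewrite lead_coef_map_inj //; [rewrite -intr_norm lc1|exact: intr_inj].
have lc0 : lead_coef (toC h) != 0 by rewrite -normr_eq0 lcC1 oner_eq0.
have le2 : {in rs, forall z, `|z| <= 2}.
  move=> z zrs; apply: (@root_littlewood_le2 n T).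
  rewrite -(map_littlewood intr) fhq rmorphM /= rootM.
  by rewrite hrs rootZ ?root_prod_XsubC ?zrs.
have szrs : (size rs <= A)%N.
  apply: leq_trans leA.
  rewrite -(size_map_inj_poly (f := intr : int -> algC)) //; last exact: intr_inj.
  by rewrite hrs size_scale // size_prod_XsubC.
have : `|(toC h)`_i| <= 3 ^+ A.
  rewrite hrs coefZ normrM lcC1 mul1r.
  by rewrite (le_trans (norm_coef_prod_XsubC i le2)) // ler_weXn2l // ler1n.
by rewrite coef_map -intr_norm -(ler_int algC) rmorphXn.
Qed.

(** There are only finitely many candidates for a factor of size at most [A],
    whatever [n] is; the list [l] contains all their roots. *)
Lemma small_factor_root A : exists l : seq algC,
  forall n (T : {set 'I_n.+1}) (h q : {poly int}), littlewood int T = h * q ->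
    (1 < size h <= A)%N -> has (root (littlewood algC T)) l.
Proof.
(* [pol] enumerates the polynomials of size at most A with coefficients in
   [-3^A, 3^A], each coefficient being shifted by 3^A into 'I_N. *)
pose N := (2 * 3 ^ A).+1.
pose pol (f : {ffun 'I_A -> 'I_N}) : {poly int} :=
  \poly_(i < A) (if insub i is Some j then (f j : nat)%:Z - 3 ^+ A else 0).
pose roots f := sval (closed_field_poly_normal (toC (pol f))).
exists (flatten [seq roots f | f : {ffun 'I_A -> 'I_N}]).
move=> n T h q fhq /andP[h_gt1 h_le].
pose f := [ffun i : 'I_A => inord (absz (h`_i + 3 ^+ A)%R) : 'I_N].
have hf : h = pol f.
  apply/polyP=> i; rewrite coef_poly; case: ltnP => [ltiA|leAi]; last first.
    by rewrite nth_default // (leq_trans h_le).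
  have h_bound := coef_factor_littlewood i fhq h_le.
  rewrite insubT ffunE /= inordK.
    rewrite gez0_abs ?addrK // -lerBlDr sub0r.
    by move: h_bound; rewrite ler_norml => /andP[].
  have E : (2 * 3 ^ A)%N = 3 ^+ A + 3 ^+ A :> int.
    by rewrite mul2n -addnn PoszD -[Posz (3 ^ A)]natz natrX.
  rewrite ltnS -lez_nat abszE E (le_trans (ler_normD _ _)) // lerD //.
  by rewrite ger0_norm // exprn_ge0.
have [a ra] : exists a, root (toC h) a.
  apply/closed_rootP; rewrite size_map_inj_poly //; last exact: intr_inj.
  by rewrite neq_ltn h_gt1 orbT.
apply/hasP; exists a; last first.
  by rewrite -(map_littlewood intr) fhq rmorphM /= rootM ra.
apply/flattenP; exists (roots f); first exact: image_f.
move: ra; rewrite /roots -hf; case: (closed_field_poly_normal _) => rs /= hrs.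
rewrite hrs rootZ ?root_prod_XsubC // lead_coef_eq0 -size_poly_eq0.
rewrite size_map_inj_poly //; last exact: intr_inj.
by rewrite -lt0n ltnW.
Qed.

Lemma vanishing_rare (a : algC) K : exists n0, forall n, (n0 <= n)%N ->
  (K * #|vanishing n a| <= 2 ^ n.+1)%N.
Proof.
have [[M [M_gt0 aM1]]|a_free] := pselect (exists M, (0 < M)%N /\ a ^+ M = 1).
  exists (K ^ 4 * M)%N => n le_n; apply: (card_vanishing_unity M_gt0 aM1).
  by rewrite leq_divRL.
exists K => n leKn; rewrite mulnC.
apply: leq_trans (@card_vanishing_nonunity n a _).
  by rewrite leq_mul2l ltnW ?orbT.
by move=> M M_gt0; apply/eqP=> aM1; apply: a_free; exists M.
Qed.

Lemma vanishing_somewhere_rare (l : seq algC) K :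
  exists n0, forall n, (n0 <= n)%N ->
  (K * #|[set T : {set 'I_n.+1} | has (root (littlewood algC T)) l]|
     <= 2 ^ n.+1)%N.
Proof.
elim: l K => [|a l IH] K.
  by exists 0 => n _; rewrite eq_card0 ?muln0 // => T; rewrite !inE.
have [n1 H1] := vanishing_rare a (2 * K); have [n2 H2] := IH (2 * K)%N.
exists (maxn n1 n2) => n; rewrite geq_max => /andP[/H1{}H1 /H2{}H2].
set S := [set T | _] in H2; set V := [set T | _].
have : (#|V| <= #|vanishing n a| + #|S|)%N.
  rewrite -cardsUI (leq_trans _ (leq_addr _ _)) // subset_leq_card //.
  by apply/subsetP=> T; rewrite !inE /=.
move: H1 H2; nia.
Qed.

(** * Reducible sign polynomials are rare in degree 2 ^ k - 1 *)

(** Gauss's lemma: the factorization over the rationals can be taken over the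
    integers. *)
Lemma not_irreducible_factor n (T : {set 'I_n.+1}) : (0 < n)%N ->
    ~ irreducible_poly (littlewood rat T) ->
  exists h q, [/\ littlewood int T = h * q, (1 < size h)%N & (1 < size q)%N].
Proof.
move=> n_gt0; rewrite -(map_littlewood intr) irreducible_rat_int => red_f.
apply: contrapT => no_factor; apply: red_f.
have f0 : littlewood int T != 0 by rewrite -size_poly_eq0 size_littlewood.
split=> [|p p_n1 p_dvd]; first by rewrite size_littlewood.
have [r fpr] := dvdpP_int p_dvd.
have p0 : p != 0 by apply: contraNneq f0 => p0; move: p_dvd; rewrite p0 dvd0p.
have r0 : r != 0 by apply: contraNneq f0 => r0; rewrite fpr r0 mulr0.
have : (size r <= 1)%N.
  rewrite leqNgt; apply/negP=> r_gt1; apply: no_factor.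
  exists (zprimitive p), r; split=> //.
  by rewrite size_zprimitive ltn_neqAle eq_sym p_n1 size_poly_gt0.
rewrite -dvdp_size_eqp // fpr size_mul ?zprimitive_eq0 // size_zprimitive => r1.
by rewrite (_ : size r = 1%N) ?addn1 //; apply/eqP; rewrite eqn_leq r1 size_poly_gt0.
Qed.

Definition reducible_signs n :=
  [set T : {set 'I_n.+1} | `[< ~ irreducible_poly (littlewood rat T) >]].

(** The proportion of reducible polynomials is made at most [1 / K] by giving
    half of it to the event that the low coefficients are divisible by 4,
    which explains the choice [A = 2 K] (as [2 K <= 2 ^ A]), and half of it to
    the vanishing at a root of a small factor. *)
Lemma reducible_rare K :
  exists k0, forall k n, (k0 <= k)%N -> n.+1 = (2 ^ k)%N ->
  (K * #|reducible_signs n| <= 2 ^ n.+1)%N.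
Proof.
pose A := (2 * K)%N; have [l l_root] := small_factor_root A.
have [n0 l_rare] := vanishing_somewhere_rare l (2 * K).
exists (maxn A n0).+1 => k n lek nk.
have le_kn : (k <= n)%N by rewrite -ltnS nk ltn_expl.
have := l_rare n ltac:(lia).
have := card_low_coefs_dvd4 (n := n) (A := A) ltac:(lia).
set S := [set T | has _ _]; set E := low_coefs_dvd4 n A => leE leS.
have : (#|reducible_signs n| <= #|E| + #|S|)%N.
  rewrite -cardsUI (leq_trans _ (leq_addr _ _)) // subset_leq_card //.
  apply/subsetP=> T; rewrite [T \in reducible_signs n]inE => /asboolP.
  have n_gt0 := leq_trans (leq_ltn_trans (leq0n _) lek) le_kn.
  case/(not_irreducible_factor n_gt0) => h [q [fhq h_gt1 q_gt1]].
  rewrite inE; have [le_h|lt_h] := leqP (size h) A.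
    by rewrite [T \in S]inE (l_root _ _ _ _ fhq) ?h_gt1 ?orbT.
  have [le_q|lt_q] := leqP (size q) A.
    by rewrite [T \in S]inE (l_root _ _ q h) ?q_gt1 ?orbT // mulrC.
  rewrite [T \in E]inE; apply/orP; left; apply/forallP=> i.
  exact: dvdz4_coef_shift1 nk fhq lt_h lt_q _ (ltn_ord i).
have le2K : (2 * K * #|E| <= 2 ^ n.+1)%N.
  apply: leq_trans leE; rewrite leq_mul2r; apply/orP; right.
  by apply/ltnW/ltn_expl.
move=> le_red; rewrite -(leq_pmul2l (isT : (0 < 2)%N)) mulnA.
apply: leq_trans (_ : (2 * K * (#|E| + #|S|) <= _)%N).
  by rewrite leq_mul2l le_red orbT.
by rewrite mulnDr [leqRHS]mul2n -addnn leq_add.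
Qed.

(** * From counting to probabilities *)

From mathcomp Require Import all_classical all_reals all_analysis.

Local Open Scope classical_set_scope.
Local Open Scope ring_scope.

Section Probability.
Context (R : realType) (d : measure_display) (T : measurableType d).
Context (P : probability T R) (n : nat) (eps : 'I_n.+1 -> {RV P >-> int}).

Definition atom (v : 'I_n.+1 -> int) : set T := [set w | forall i, eps i w = v i].

Lemma measurable_atom v : measurable (atom v).
Proof.
have -> : atom v = \bigcap_(i in setT) (eps i @^-1` [set v i]).
  by apply/seteqP; split=> w H i //; [move=> _; apply: H|apply: (H i)].
by apply: fin_bigcap_measurable => // i _; exact: measurable_funPTI.
Qed.

(** The coefficient vector takes its values in a countable set, so the event is
    a countable union of atoms. *)
Lemma measurable_irreducible :
  measurable [set w | irreducible_poly (random_poly eps w)].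
Proof.
pose F (v : {ffun 'I_n.+1 -> int}) : set T :=
  [set w | irreducible_poly (random_poly eps w)] `&` atom v.
have -> : [set w | irreducible_poly (random_poly eps w)] = \bigcup_v F v.
  apply/seteqP; split=> [w irr_w|w [v _ []] //].
  by exists [ffun i => eps i w] => //; split=> // i; rewrite ffunE.
apply: countable_bigcupT_measurable; first exact: countableP.
move=> v; pose p : {poly rat} := \sum_(i < n.+1) (v i)%:~R *: 'X^i.
have poly_atom w : atom v w -> random_poly eps w = p.
  by move=> w_v; apply: eq_bigr => i _; rewrite w_v.
have [irr_p|red_p] := pselect (irreducible_poly p).
  suff -> : F v = atom v by exact: measurable_atom.
  by apply/seteqP; split=> [w []//|w w_v]; split=> //=; rewrite poly_atom.
suff -> : F v = set0 by exact: measurable0.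
by apply/seteqP; split=> [w [/= + w_v]|//]; rewrite poly_atom.
Qed.

Hypothesis eps_sign : forall i, random_sign (eps i).
Hypothesis eps_indep : mutually_independent eps.

Lemma prob_sign_pattern (S : {set 'I_n.+1}) :
  P (atom (fun i => (-1) ^+ (i \in S))) = (2^-1 ^+ n.+1)%:E.
Proof.
have -> : atom (fun i => (-1) ^+ (i \in S)) =
    [set w | forall i, i \in [set: 'I_n.+1]%SET ->
      [set (-1) ^+ (i \in S)] (eps i w)].
  by apply/seteqP; split=> w H i; [move=> _|]; apply: (H i); rewrite inE.
rewrite (eps_indep (A := fun i => [set (-1) ^+ (i \in S)])) //.
rewrite (eq_bigr (fun=> (2^-1)%:E)) => [|i _]; last first.
  by have [] := eps_sign i; case: (i \in S).
by rewrite -(big_morph EFin (@EFinM R) erefl) prodr_const cardsT card_ord.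
Qed.

(** This is only an inequality because the variables may take values other than
    [1] and [-1] on a null set, where the polynomial can be irreducible too. *)
Lemma prob_irreducible_ge :
  (((#|~: reducible_signs n|)%:R / 2 ^+ n.+1)%:E <=
   P [set w | irreducible_poly (random_poly eps w)])%E.
Proof.
pose F (S : {set 'I_n.+1}) := atom (fun i => (-1) ^+ (i \in S)).
pose r := enum (~: reducible_signs n).
apply: (@le_trans _ _ (P (\bigcup_(S in [set` r]) F S))); last first.
  apply: le_measure; rewrite ?inE.
  - by apply: fin_bigcup_measurable => // S _; exact: measurable_atom.
  - exact: measurable_irreducible.
  move=> w [S /=]; rewrite mem_enum !inE => /asboolPn; rewrite notK => irr_S w_S.
  suff -> : random_poly eps w = littlewood rat S by [].
  rewrite littlewoodE; apply: eq_bigr => i _.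
  by rewrite w_S rmorph_sign.
rewrite measure_fin_bigcup //; last first.
- by move=> S _; exact: measurable_atom.
- move=> S S' _ _ [w [w_S w_S']]; apply/setP=> i.
  have := w_S i; rewrite w_S' => /eqP.
  by case: (_ \in S); case: (_ \in S').
rewrite -fsbig_seq ?enum_uniq // big_enum /=.
rewrite (eq_bigr (fun=> (2^-1 ^+ n.+1)%:E)) => [|S _]; last exact: prob_sign_pattern.
by rewrite sumEFin sumr_const lee_fin exprVn mulr_natl.
Qed.

End Probability.

Theorem theorem1p1 (R : realType) (d : nat -> measure_display)
    (T : forall n : nat, measurableType (d n))
    (P : forall n : nat, probability (T n) R)
    (eps : forall n : nat, 'I_n.+1 -> {RV (P n) >-> int})
    (eps_sign : forall n : nat, (1 <= n)%N ->
       forall i : 'I_n.+1, random_sign (eps n i))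
    (eps_indep : forall n : nat, (1 <= n)%N -> mutually_independent (eps n)) :
  limn_esup (fun n : nat =>
    P n [set w | irreducible_poly (random_poly (eps n) w)]) = 1%E.
Proof.
set u := fun n => _; rewrite limn_esup_lim.
have u_le1 n : (u n <= 1)%E by exact/probability_le1/measurable_irreducible.
apply/eqP; rewrite eq_le; apply/andP; split.
  apply: lime_le; first exact: is_cvg_esups.
  by apply: nearW => n; apply/ereal_supP => _ [m _ <-].
apply: lime_ge; first exact: is_cvg_esups.
apply: nearW => N; apply/lee_addgt0Pr => e e_gt0.
pose K := (Num.truncn e^-1).+1.
have ltK : e^-1 < K%:R by rewrite truncnS_gt.
have [k0 rare] := reducible_rare K.
pose k := (maxn k0 N).+1; pose n := (2 ^ k).-1.
have nk : n.+1 = (2 ^ k)%N by rewrite prednK // expn_gt0.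
have le_kn : (k <= n)%N by rewrite -ltnS nk ltn_expl.
have leKr := rare k n ltac:(lia) nk.
apply: (@le_trans _ _ (u n + e%:E)%E); last first.
  by rewrite leeD2r //; apply: ereal_sup_ubound; exists n => //=; lia.
have n_gt0 : (1 <= n)%N by lia.
have irr_ge := prob_irreducible_ge (eps_sign n n_gt0) (eps_indep n n_gt0).
apply: le_trans (leeD2r _ irr_ge).
rewrite -EFinD lee_fin.
have M_gt0 : 0 < 2 ^+ n.+1 :> R by rewrite exprn_gt0.
have total : 2 ^+ n.+1 =
    #|reducible_signs n|%:R + #|~: reducible_signs n|%:R :> R.
  by rewrite -natrD cardsC -cardsT -powersetT card_powerset cardsT card_ord natrX.
have Ke_ge1 : 1 <= K%:R * e by rewrite -ler_pdivrMr // div1r ltW.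
have leKr_R : K%:R * #|reducible_signs n|%:R <= 2 ^+ n.+1 :> R.
  by rewrite -natrM -natrX ler_nat.
rewrite -(ler_pM2r M_gt0) mul1r mulrDl divfK ?gt_eqF // [leLHS]total addrC lerD2l.
rewrite (le_trans (_ : _ <= e * (K%:R * #|reducible_signs n|%:R))) //.
  by rewrite mulrA [e * _]mulrC ler_peMl.
by rewrite ler_pM2l.
Qed.
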